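(* Let $G$ be a chain graph with $n$ viewpoints and let $m\le n$ be the number of robots. Let $\mathcal{V}=\{V_1,\dots,V_m\}$ be an optimal (minimum dimension) $m$-partition of $G$ computed by means of the bisection algorithm below with tolerance $\varepsilon$, and let $d_{\max}$ be the dimension of $\mathcal V$. Let $l_i=\min_{v\in V_i}v$, $r_i=\max_{v\in V_i}v$, $d_i=r_i-l_i$, and let robot $i$ follow the trajectory with $x_i(t)=l_i$ for $t=0,2d_i,4d_i,\dots$ and $x_i(t)=r_i$ for $t=d_i,3d_i,5d_i,\dots$, moving at unit speed in between. This team trajectory has image $\mathcal{V}$ and minimum refresh time $2d_{\max}$. Moreover, the time complexity of designing such a trajectory is $O(n\log(\varepsilon^{-1}))$.
   Context: A chain roadmap has viewpoints $1,\dots,n$ and edges $\{i,i+1\}$ of positive length; points are identified with their distance from vertex $1$, so viewpoints are reals $0=v_1<\dots<v_n$. A team trajectory is $X=(x_1,\dots,x_m)$, $x_i:[0,T_f]\to[0,v_n]$ continuous, piecewise differentiable, speed at most $1$, where $T_f$ is a fixed horizon much larger than the time a single robot needs to visit all viewpoints. $\mathrm{RT}(X)=\max_v\max_{(t_1,t_2)\in\Omega(v,X)}(t_2-t_1)$, $\Omega(v,X)=\{(t_1,t_2)\in[0,T_f]^2:t_1\le t_2,\ x_i(t)\ne v\ \forall i,\ \forall t\in(t_1,t_2)\}$. The image of $X$ is $\{V_1,\dots,V_m\}$ where $V_i$ is the set of viewpoints visited by robot $i$. An $m$-partition is a collection of $m$ pairwise disjoint (possibly empty) subsets of the viewpoints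 with union all viewpoints; dimension $=\max_i(\max V_i-\min V_i)$. Left-induced partition $\Pi^\rho$: $a_1=v_1$, $a_j=\min\{v:v>a_{j-1}+\rho\}$ while nonempty, clusters $\{v: a_j\le v\le a_j+\rho\}$. Bisection algorithm with tolerance $0<\varepsilon<v_n/m$: $a:=0$, $b:=2v_n/m$, $\rho:=(a+b)/2$; while $b-a>2\varepsilon$: if $|\Pi^\rho|>m$ then $a:=\rho$ else $\Pi^*:=\Pi^\rho$, $b:=\rho$; $\rho:=(a+b)/2$; return $\Pi^*$. *)

(* Defs.v *)
From HB Require Import structures.
From mathcomp Require Import all_boot all_order all_algebra.
From mathcomp Require Import all_classical all_reals all_analysis.
From mathcomp Require Import ring lra.
(* so that [set0], [setT], ... denote finite sets of viewpoints *)
From mathcomp Require Import finset.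

Set Implicit Arguments.
Unset Strict Implicit.
Unset Printing Implicit Defensive.

Import Order.TTheory GRing.Theory Num.Theory.
Import numFieldNormedType.Exports.
Local Open Scope ring_scope.

(** * Chain roadmaps and partitions *)

(* The viewpoints are the indices [k : 'I_n] and [v k] is the distance of
   viewpoint [k] from the first one. *)
Definition chain (R : realType) (n : nat) (v : 'I_n -> R) : Prop :=
  (forall k : 'I_n, nat_of_ord k = 0%N -> v k = 0) /\
  (forall j k : 'I_n, (j < k)%N -> v j < v k).

(* [v_n]: the position of the last viewpoint. *)
Definition chain_length (R : realType) (n : nat) (v : 'I_n -> R) : R :=
  \big[Num.max/0]_(k < n) v k.

Definition m_partition (n m : nat) (V : 'I_m -> {set 'I_n}) : Prop :=
  (forall i j : 'I_m, i != j -> [disjoint V i & V j]) /\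
  \bigcup_(i < m) V i = [set: 'I_n].

(* On a chain, positions lie in [0, v_n], so the neutral elements [v_n] and [0]
   do not affect the minimum and maximum over a nonempty cluster. *)
Definition left_end (R : realType) (n : nat) (v : 'I_n -> R)
    (A : {set 'I_n}) : R :=
  \big[Num.min/chain_length v]_(k in A) v k.

Definition right_end (R : realType) (n : nat) (v : 'I_n -> R)
    (A : {set 'I_n}) : R :=
  \big[Num.max/0]_(k in A) v k.

(* Empty clusters do not count: they would contribute [0 - v_n <= 0]. *)
Definition dimension (R : realType) (n m : nat) (v : 'I_n -> R)
    (V : 'I_m -> {set 'I_n}) : R :=
  \big[Num.max/0]_(i < m) (right_end v (V i) - left_end v (V i)).

Definition optimal_partition (R : realType) (n m : nat) (v : 'I_n -> R)
    (V : 'I_m -> {set 'I_n}) : Prop :=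
  m_partition V /\
  forall W : 'I_m -> {set 'I_n}, m_partition W ->
    dimension v V <= dimension v W.

(** * Team trajectories and refresh time *)

(* Only the values on [0, Tf] matter.  Piecewise differentiable: differentiable
   at every interior time outside some finite list of times. *)
Definition robot_trajectory (R : realType) (Tf len : R) (x : R -> R) : Prop :=
  [/\ {within `[0, Tf], continuous x}%classic,
      forall t : R, 0 <= t <= Tf -> 0 <= x t <= len
    & exists s : seq R, forall t : R, 0 < t < Tf -> t \notin s ->
        derivable x t 1 /\ `|x^`()%classic t| <= 1].

Definition team_trajectory (R : realType) (n m : nat) (v : 'I_n -> R) (Tf : R)
    (X : 'I_m -> R -> R) : Prop :=
  forall i : 'I_m, robot_trajectory Tf (chain_length v) (X i).

Definition Omega (R : realType) (m : nat) (Tf : R) (X : 'I_m -> R -> R)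
    (p : R) : set (R * R) :=
  [set t | [/\ 0 <= t.1 <= Tf, 0 <= t.2 <= Tf, t.1 <= t.2
             & forall (i : 'I_m) (s : R), t.1 < s < t.2 -> X i s != p]]%classic.

(* The inner maximum is written as a supremum: for continuous trajectories
   [Omega] is compact, so that it is attained. *)
Definition refresh_time (R : realType) (n m : nat) (v : 'I_n -> R) (Tf : R)
    (X : 'I_m -> R -> R) : R :=
  \big[Num.max/0]_(k < n) sup [set t.2 - t.1 | t in Omega Tf X (v k)]%classic.

Definition image_of (R : realType) (n m : nat) (v : 'I_n -> R) (Tf : R)
    (X : 'I_m -> R -> R) (i : 'I_m) : {set 'I_n} :=
  [set k : 'I_n | `[< exists t : R, 0 <= t <= Tf /\ X i t = v k >]]%SET.

(* Unit-speed motion from [l] to [r] and back, with period [2 * (r - l)]: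
   see [zigzag_up] and [zigzag_down]. *)
Definition zigzag (R : realType) (l r t : R) : R :=
  let d := r - l in
  if d == 0 then l else
  let s := t - (Num.floor (t / (2 * d)))%:~R * (2 * d) in
  l + Num.min s (2 * d - s).

(* A robot without viewpoints stays at its parking point [park i]. *)
Definition partition_trajectory (R : realType) (n m : nat) (v : 'I_n -> R)
    (V : 'I_m -> {set 'I_n}) (park : 'I_m -> R) (i : 'I_m) (t : R) : R :=
  if V i == set0 then park i
  else zigzag (left_end v (V i)) (right_end v (V i)) t.

Lemma zigzag_up (R : realType) (l r t : R) (k : nat) : l < r ->
  (2 * k)%:R * (r - l) <= t <= (2 * k).+1%:R * (r - l) ->
  zigzag l r t = l + (t - (2 * k)%:R * (r - l)).
Proof.
move=> lr; have d0 : 0 < r - l by rewrite subr_gt0.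
rewrite /zigzag gt_eqF // -natr1 natrM; set d := r - l in d0 *.
move=> /andP[t1 t2].
have -> : Num.floor (t / (2 * d)) = k%:Z.
  apply: Num.Theory.floor_def.
  rewrite ler_pdivlMr ?ltr_pdivrMr ?mulr_gt0 // ?intrD -?pmulrn.
  by apply/andP; split; lra.
rewrite -pmulrn min_l; last by lra.
lra.
Qed.

Lemma zigzag_down (R : realType) (l r t : R) (k : nat) : l < r ->
  (2 * k).+1%:R * (r - l) <= t <= (2 * k).+2%:R * (r - l) ->
  zigzag l r t = r - (t - (2 * k).+1%:R * (r - l)).
Proof.
move=> lr; have d0 : 0 < r - l by rewrite subr_gt0.
rewrite /zigzag gt_eqF // -(natr1 (2 * k).+1) -(natr1 (2 * k)) natrM.
have [d dE] : {d | r - l = d} by exists (r - l).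
rewrite dE in d0 *.
move=> /andP[t1]; rewrite le_eqVlt => /orP[/eqP t2|t2].
  have -> : Num.floor (t / (2 * d)) = k.+1%:Z.
    apply: Num.Theory.floor_def.
    rewrite ler_pdivlMr ?ltr_pdivrMr ?mulr_gt0 // ?intrD -?pmulrn -natr1.
    by apply/andP; split; lra.
  rewrite -pmulrn -natr1 min_l; last by lra.
  lra.
have -> : Num.floor (t / (2 * d)) = k%:Z.
  apply: Num.Theory.floor_def.
  rewrite ler_pdivlMr ?ltr_pdivrMr ?mulr_gt0 // ?intrD -?pmulrn.
  by apply/andP; split; lra.
rewrite -pmulrn min_r; last by lra.
lra.
Qed.

(** * Left-induced partitions *)

Definition next_anchor (R : realType) (n : nat) (v : 'I_n -> R) (x : R) :
    option 'I_n :=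
  [pick k : 'I_n | (x < v k) && [forall j : 'I_n, (x < v j) ==> (v k <= v j)]].

(* For [0 <= rho] each anchor is larger than the previous one, so that [n]
   units of fuel are never exhausted. *)
Fixpoint anchors_from (R : realType) (n : nat) (v : 'I_n -> R) (rho : R)
    (fuel : nat) (a : 'I_n) : seq 'I_n :=
  a :: (if fuel is fuel'.+1 then
          if next_anchor v (v a + rho) is Some b
          then anchors_from v rho fuel' b else [::]
        else [::]).

Definition anchors (R : realType) (n : nat) (v : 'I_n -> R) (rho : R) :
    seq 'I_n :=
  if [pick k : 'I_n | nat_of_ord k == 0%N] is Some a
  then anchors_from v rho n a else [::].

Definition left_induced (R : realType) (n : nat) (v : 'I_n -> R) (rho : R) :
    seq {set 'I_n} :=
  [seq [set k : 'I_n | v a <= v k <= v a + rho]%SET | a <- anchors v rho].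

(** * Programs with a running time *)

(* [(x, c)]: the value [x], computed in [c] elementary steps.  An elementary
   step is an arithmetic operation or a comparison on reals or counters, the
   access to the position of a viewpoint, or one list operation. *)
Definition timed (A : Type) : Type := (A * nat)%type.
Definition ret (A : Type) (x : A) : timed A := (x, 0%N).
Definition steps (A : Type) (c : nat) (x : A) : timed A := (x, c).
Definition op (A : Type) (x : A) : timed A := steps 1 x.
Definition bind (A B : Type) (e : timed A) (f : A -> timed B) : timed B :=
  ((f e.1).1, (e.2 + (f e.1).2)%N).

Notation "'do' x <- e1 ; e2" := (bind e1 (fun x => e2))
  (at level 200, x name, e1 at level 100, e2 at level 200).
Notation "'do' ' p <- e1 ; e2" := (bind e1 (fun p => e2))
  (at level 200, p pattern, e1 at level 100, e2 at level 200).

(* Big-step semantics: the loop started in state [s] ends in state [s'] after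
   [c] elementary steps. *)
Inductive while (S : Type) (guard : S -> timed bool) (body : S -> timed S) :
    S -> S -> nat -> Prop :=
| while_stop (s : S) :
    (guard s).1 = false -> while guard body s s (guard s).2
| while_iter (s s' : S) (c : nat) :
    (guard s).1 = true -> while guard body (body s).1 s' c ->
    while guard body s s' ((guard s).2 + (body s).2 + c).

(** * The bisection algorithm *)

(* The state consists of [a], [b], [rho] and of the partition found so far.
   The algorithm is parametrized by the type of clusters and by the subroutine
   [Pi] computing the left-induced partition for a given [rho]. *)
Definition bisection_state (R : realType) (A : Type) : Type :=
  (R * R * R * option (seq A))%type.

Definition bisection_init (R : realType) (A : Type) (len : R) (m : nat) :
    timed (bisection_state R A) :=
  do x <- op (2 * len);
  do b <- op (x / m%:R);
  do y <- op (0 + b);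
  do rho <- op (y / 2);
  ret (0, b, rho, None).

Definition bisection_guard (R : realType) (A : Type) (eps : R)
    (s : bisection_state R A) : timed bool :=
  let: (a, b, _, _) := s in
  do x <- op (b - a);
  do y <- op (2 * eps);
  op (y < x).

Definition bisection_body (R : realType) (A : Type) (Pi : R -> timed (seq A))
    (m : nat) (s : bisection_state R A) : timed (bisection_state R A) :=
  let: (a, b, rho, best) := s in
  do P <- Pi rho;
  do k <- steps (size P).+1 (size P);
  do big <- op (m < k)%N;
  do '(a', b', best') <-
    op (if big then (rho, b, best) else (a, rho, Some P));
  do x <- op (a' + b');
  do rho' <- op (x / 2);
  ret (a', b', rho', best').

(* The algorithm stops after [c] elementary steps and returns [P]. *)
Definition bisection (R : realType) (A : Type) (Pi : R -> timed (seq A))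
    (len : R) (m : nat) (eps : R) (P : seq A) (c : nat) : Prop :=
  exists (a b rho : R) (c' : nat),
    while (bisection_guard eps) (bisection_body Pi m)
      (bisection_init A len m).1 (a, b, rho, Some P) c' /\
    c = ((bisection_init A len m).2 + c')%N.

(* The [m]-partition given by a list of at most [m] clusters: the remaining
   clusters are empty. *)
Definition pad (n m : nat) (P : seq {set 'I_n}) (i : 'I_m) : {set 'I_n} :=
  nth set0 P i.

Definition bisection_partition (R : realType) (n m : nat) (v : 'I_n -> R)
    (eps : R) (V : 'I_m -> {set 'I_n}) : Prop :=
  exists (P : seq {set 'I_n}) (c : nat),
    bisection (fun rho => ret (left_induced v rho)) (chain_length v) m eps P c
    /\ V =1 pad P.

(** * An implementation, for the running time *)

(* A single scan of the viewpoints.  [scan_from v rho a s] returns the elements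
   of [s] belonging to the cluster anchored at position [a], together with the
   subsequent clusters. *)
Fixpoint scan_from (R : realType) (n : nat) (v : 'I_n -> R) (rho a : R)
    (s : seq 'I_n) : timed (seq 'I_n * seq (seq 'I_n)) :=
  if s is k :: s' then
    do x <- op (v k);
    do y <- op (a + rho);
    do near <- op (x <= y);
    if near then
      do '(c, cs) <- scan_from v rho a s';
      do c' <- op (k :: c);
      ret (c', cs)
    else
      do '(c, cs) <- scan_from v rho x s';
      do c' <- op (k :: c);
      do cs' <- op (c' :: cs);
      ret ([::], cs')
  else op ([::], [::]).

Definition scan (R : realType) (n : nat) (v : 'I_n -> R) (rho : R) :
    timed (seq (seq 'I_n)) :=
  if enum 'I_n is k :: s then
    do x <- op (v k);
    do '(c, cs) <- scan_from v rho x s;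
    do c' <- op (k :: c);
    op (c' :: cs)
  else op [::].

Fixpoint timed_last (T : Type) (x : T) (s : seq T) : timed T :=
  if s is y :: s' then do z <- op y; timed_last z s' else op x.

(* The end points of the trajectories of [m] robots, [None] for a robot without
   viewpoints. *)
Fixpoint robot_ends (R : realType) (n : nat) (v : 'I_n -> R) (m : nat)
    (P : seq (seq 'I_n)) : timed (seq (option (R * R))) :=
  match m, P with
  | m'.+1, (k :: c) :: P' =>
      do l <- op (v k);
      do j <- timed_last k c;
      do r <- op (v j);
      do ends <- robot_ends v m' P';
      op (Some (l, r) :: ends)
  | m'.+1, _ =>
      do ends <- robot_ends v m' (behead P);
      op (None :: ends)
  | 0, _ => op [::]
  end%N.

(* The design procedure stops after [c] elementary steps and returns [ends]. *)
Definition design (R : realType) (n : nat) (v : 'I_n -> R) (m : nat) (eps : R)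
    (ends : seq (option (R * R))) (c : nat) : Prop :=
  exists (P : seq (seq 'I_n)) (c' : nat),
    bisection (scan v) (chain_length v) m eps P c' /\
    ends = (robot_ends v m P).1 /\ c = (c' + (robot_ends v m P).2)%N.

Definition partition_ends (R : realType) (n m : nat) (v : 'I_n -> R)
    (V : 'I_m -> {set 'I_n}) : seq (option (R * R)) :=
  [seq if V i == set0 then None
       else Some (left_end v (V i), right_end v (V i)) | i <- enum 'I_m].

(* Main.v *)
Require Import Defs.
From mathcomp Require Import all_boot all_order all_algebra.
From mathcomp Require Import all_classical all_reals all_analysis.
From mathcomp Require Import ring lra zify.
From mathcomp Require Import finset.

Set Implicit Arguments.
Unset Strict Implicit.
Unset Printing Implicit Defensive.

Import Order.TTheory GRing.Theory Num.Theory.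
Import numFieldNormedType.Exports.
Local Open Scope ring_scope.

(* Lower bound.  Suppose that the refresh time is below [2 rho] with [rho]
   smaller than the minimum dimension.  The left-induced partition [Pi^rho] has
   dimension at most [rho], so it has more than [m] clusters, with anchors at
   mutual distance larger than [rho].  Every open time window of radius [rho]
   contains a visit of each anchor; since the speed is at most [1], induction on
   [j] shows that at all times in [j rho, Tf - j rho] at least [j] robots lie to
   the left of [a_j + rho] (the robots counted for [a_{j-1}] are strictly left
   of [a_j] when some robot visits [a_j], so that this visitor is a new one).
   If [j] is the number of anchors, this is absurd; and as the anchors fit into
   [0, v_n], the time window for this [j] is nonempty as soon as [4 v_n <= Tf].

   Upper bound.  The zigzag position is [l] plus the distance of [t] to the
   multiples of [2 d]: it is 1-Lipschitz, it passes through each point of [l, r]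
   once per period at least, and through [l] only once per period.

   Running time.  For [rho = v_n / m] there are at most [m] clusters, so the
   first iteration succeeds; [b - a] is halved in each iteration, and each
   iteration is a linear scan. *)

(** * Chains and clusters of viewpoints *)

Section Chain.
Variables (R : realType) (n : nat) (v : 'I_n -> R).
Implicit Types (j k : 'I_n) (A : {set 'I_n}).

Definition extent A : R := right_end v A - left_end v A.

Definition contiguous A : Prop :=
  forall i j k, i \in A -> k \in A -> (i <= j <= k)%N -> j \in A.

Lemma chain_length_ge0 : 0 <= chain_length v.
Proof. exact: bigmax_ge_id. Qed.

Lemma chain_le_length k : v k <= chain_length v.
Proof. exact: le_bigmax. Qed.

Lemma left_end_le A k : k \in A -> left_end v A <= v k.
Proof. by move=> kA; apply: bigmin_le_cond. Qed.

Lemma right_end_ge A k : k \in A -> v k <= right_end v A.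
Proof. by move=> kA; rewrite /right_end; apply: le_bigmax_cond. Qed.

Lemma left_le_right_end A : A != set0 -> left_end v A <= right_end v A.
Proof.
by case/set0Pn => k kA; apply: le_trans (left_end_le kA) (right_end_ge kA).
Qed.

Lemma left_end_attained A :
  A != set0 -> exists2 k, k \in A & left_end v A = v k.
Proof.
case/set0Pn => j jA.
have [k kA kE] := @eq_bigmin _ _ _ (chain_length v) j (mem A) v jA
  (fun i _ => chain_le_length i).
by exists k.
Qed.

Lemma right_end_le_length A : right_end v A <= chain_length v.
Proof.
by apply: bigmax_le => [|k _]; [apply: bigmax_ge_id | apply: chain_le_length].
Qed.

Lemma extent_set0 : extent set0 <= 0.
Proof.
by rewrite /extent /right_end /left_end !big_set0 sub0r oppr_le0 bigmax_ge_id.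
Qed.

Lemma extent_le_dimension m (V : 'I_m -> {set 'I_n}) (i : 'I_m) :
  extent (V i) <= dimension v V.
Proof. exact: (@le_bigmax _ _ _ _ (fun i => extent (V i))). Qed.

Lemma dimension_ge0 m (V : 'I_m -> {set 'I_n}) : 0 <= dimension v V.
Proof. exact: bigmax_ge_id. Qed.

Hypothesis chain_v : chain v.

Lemma ltr_chain j k : (v j < v k) = (j < k)%N.
Proof.
have [jk|kj|/val_inj ->] := ltngtP j k; last by rewrite ltxx.
  by rewrite chain_v.2.
by apply/negbTE; rewrite -leNgt ltW // chain_v.2.
Qed.

Lemma ler_chain j k : (v j <= v k) = (j <= k)%N.
Proof. by rewrite leNgt ltr_chain -leqNgt. Qed.

Lemma chain_inj : injective v.
Proof.
by move=> j k jk; apply/val_inj/anti_leq; rewrite /= -!ler_chain jk lexx.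
Qed.

Lemma chain_ge0 k : 0 <= v k.
Proof.
have n_gt0 : (0 < n)%N by apply: leq_ltn_trans (ltn_ord k).
by rewrite -(chain_v.1 (Ordinal n_gt0) erefl) ler_chain.
Qed.

Lemma right_end_attained A :
  A != set0 -> exists2 k, k \in A & right_end v A = v k.
Proof.
case/set0Pn => j jA.
have [k kA kE] := @eq_bigmax _ _ _ 0 j (mem A) v jA (fun i _ => chain_ge0 i).
by exists k.
Qed.

Lemma left_end_ge0 A : 0 <= left_end v A.
Proof.
by apply: le_bigmin => [|k _]; [apply: bigmax_ge_id | apply: chain_ge0].
Qed.

Lemma extent_le A (rho : R) : 0 <= rho ->
  {in A &, forall j k, v k - v j <= rho} -> extent A <= rho.
Proof.
move=> rho_ge0 A_rho; have [->|A_neq0] := eqVneq A set0.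
  exact: le_trans extent_set0 rho_ge0.
have [j jA lE] := left_end_attained A_neq0.
have [k kA rE] := right_end_attained A_neq0.
by rewrite /extent lE rE A_rho.
Qed.

Lemma dimension_le_length m (V : 'I_m -> {set 'I_n}) :
  dimension v V <= chain_length v.
Proof.
apply: bigmax_le => [|i _]; first exact: chain_length_ge0.
by have := right_end_le_length (V i); have := left_end_ge0 (V i); lra.
Qed.

Lemma mem_contiguous A k : contiguous A -> A != set0 ->
  (k \in A) = (left_end v A <= v k <= right_end v A).
Proof.
move=> A_contiguous A_neq0; apply/idP/idP => [kA|].
  by rewrite left_end_le ?right_end_ge.
have [i iA ->] := left_end_attained A_neq0.
have [j jA ->] := right_end_attained A_neq0.
by rewrite !ler_chain; apply: A_contiguous.
Qed.

End Chain.

Section Pad.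
Variables (R : realType) (n m : nat) (v : 'I_n -> R).
Implicit Types (P : seq {set 'I_n}) (i : 'I_m).

Lemma pad_in_or_set0 P i : pad P i = set0 \/ pad P i \in P.
Proof.
rewrite /pad; have [iP|iP] := ltnP i (size P); first by right; apply: mem_nth.
by left; apply: nth_default.
Qed.

Lemma contiguous_pad P i :
  {in P, forall A, contiguous A} -> contiguous (pad P i).
Proof.
move=> P_contiguous; have [->|/P_contiguous //] := pad_in_or_set0 P i.
by move=> j k h; rewrite inE.
Qed.

Lemma dimension_pad_le P (rho : R) : 0 <= rho ->
  {in P, forall A, extent v A <= rho} -> dimension v (pad (m := m) P) <= rho.
Proof.
move=> rho_ge0 P_rho; apply: bigmax_le => // i _.
have [->|/P_rho //] := pad_in_or_set0 P i.
exact: le_trans (extent_set0 v) rho_ge0.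
Qed.

Lemma m_partition_pad P :
  pairwise (fun A B : {set 'I_n} => [disjoint A & B]) P ->
  (forall k, exists2 A, A \in P & k \in A) -> (size P <= m)%N ->
  m_partition (pad (m := m) P).
Proof.
move=> P_disjoint P_cover P_size; split=> [i j i_neq_j|].
  wlog ij : i j i_neq_j / (i < j)%N.
    move=> W; have [/W|/W|/val_inj E] := ltngtP i j; first exact.
      by rewrite disjoint_sym; apply; rewrite eq_sym.
    by rewrite E eqxx in i_neq_j.
  have [jP|jP] := ltnP j (size P).
    by move/pairwiseP: P_disjoint => -> //; rewrite inE // (ltn_trans ij).
  by rewrite [pad P j]nth_default // -setI_eq0 setI0.
apply/setP => k; rewrite inE; have [A AP kA] := P_cover k.
have AP_lt_m : (index A P < m)%N by apply: leq_trans P_size; rewrite index_mem.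
by apply/bigcupP; exists (Ordinal AP_lt_m); rewrite // /pad nth_index.
Qed.

End Pad.

(** * Left-induced partitions *)

Section LeftInduced.
Variables (R : realType) (n : nat) (v : 'I_n -> R).
Implicit Types (a b j k : 'I_n) (rho : R) (s : seq 'I_n).

Local Notation beyond rho := (fun j k : 'I_n => v j + rho < v k).

Definition separated rho s : bool := pairwise (beyond rho) s.

Definition cluster rho a : {set 'I_n} := [set k | v a <= v k <= v a + rho]%SET.

Lemma left_inducedE rho :
  left_induced v rho = map (cluster rho) (anchors v rho).
Proof. by []. Qed.

Lemma next_anchor_None (x : R) :
  next_anchor v x = None <-> forall k, v k <= x.
Proof.
rewrite /next_anchor; case: pickP => [k /andP[xk _]|no_next]; split=> //.
  by move/(_ k); rewrite leNgt xk.
move=> _ k; rewrite leNgt; apply/negP => xk.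
have [b xb b_min] := @arg_minP _ _ _ k (fun j => x < v j) v xk.
have /negP[] := negbT (no_next b); rewrite xb; apply/forallP => j.
by apply/implyP => /b_min.
Qed.

Lemma anchors_from_cons rho fuel a :
  anchors_from v rho fuel a = a :: behead (anchors_from v rho fuel a).
Proof. by case: fuel. Qed.

Hypothesis chain_v : chain v.

Lemma next_anchorP (x : R) b :
  next_anchor v x = Some b <-> x < v b /\ forall j, x < v j -> v b <= v j.
Proof.
rewrite /next_anchor; case: pickP => [k /andP[xk /forallP k_min]|no_next].
  split=> [[<-]|[xb b_min]].
    by split=> // j xj; apply: (implyP (k_min j)).
  congr Some; apply/(chain_inj chain_v)/le_anti.
  by rewrite b_min // (implyP (k_min b)).
split=> // -[xb b_min]; have /negP[] := negbT (no_next b).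
by rewrite xb; apply/forallP => j; apply/implyP => /b_min.
Qed.

Lemma next_anchor_first (x : R) k :
  (forall j, (j < k)%N -> v j <= x) -> x < v k -> next_anchor v x = Some k.
Proof.
move=> before_k xk; apply/next_anchorP; split=> // j xj.
by rewrite ler_chain // leqNgt; apply/negP => /before_k; rewrite leNgt xj.
Qed.

Lemma anchors_from_path rho fuel a :
  path (beyond rho) a (behead (anchors_from v rho fuel a)).
Proof.
elim: fuel a => [//|fuel IH] a /=.
case nx: (next_anchor _ _) => [b|//]; move/next_anchorP: nx => [ab _].
by rewrite anchors_from_cons /= ab IH.
Qed.

Lemma anchors_separated rho : 0 <= rho -> separated rho (anchors v rho).
Proof.
move=> rho_ge0; rewrite /separated -sorted_pairwise; last first.
  by move=> k j h; lra.
rewrite /anchors; case: pickP => // a _.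
by rewrite anchors_from_cons; apply: anchors_from_path.
Qed.

Lemma anchors_from_cover rho fuel a k : 0 <= rho -> (n <= fuel + a)%N ->
  v a <= v k ->
  exists2 b, b \in anchors_from v rho fuel a & k \in cluster rho b.
Proof.
move=> rho_ge0; elim: fuel a => [|fuel IH] a fuel_a ak.
  by have := ltn_ord a; rewrite ltnNge fuel_a.
have [ka|ka] := leP (v k) (v a + rho).
  by exists a; rewrite inE ?eqxx // ak.
rewrite /=; case nx: (next_anchor _ _) => [b|]; last first.
  by move/next_anchor_None: nx => /(_ k); rewrite leNgt ka.
move/next_anchorP: nx => [ab b_min].
have a_lt_b : (a < b)%N by rewrite -(ltr_chain chain_v); lra.
have [|c cb kc] := IH b _ (b_min k ka); first lia.
by exists c; rewrite // inE cb orbT.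
Qed.

Lemma anchors_cover rho k : 0 <= rho ->
  exists2 b, b \in anchors v rho & k \in cluster rho b.
Proof.
move=> rho_ge0; rewrite /anchors; case: pickP => [a /eqP a0|no0].
  apply: anchors_from_cover; rewrite ?leq_addr //.
  by rewrite chain_v.1 ?(chain_ge0 chain_v).
have n_gt0 : (0 < n)%N by apply: leq_ltn_trans (ltn_ord k).
by have := no0 (Ordinal n_gt0); rewrite eqxx.
Qed.

Lemma left_induced_disjoint rho : 0 <= rho ->
  pairwise (fun A B : {set 'I_n} => [disjoint A & B]) (left_induced v rho).
Proof.
move=> rho_ge0; rewrite left_inducedE pairwise_map.
apply: sub_pairwise (anchors_separated rho_ge0) => a b /= ab.
rewrite -setI_eq0; apply/eqP/setP => k; rewrite !inE.
by apply/negbTE/negP => /andP[/andP[_ ka] /andP[bk _]]; lra.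
Qed.

Lemma left_induced_m_partition m rho : 0 <= rho ->
  (size (anchors v rho) <= m)%N ->
  m_partition (pad (m := m) (left_induced v rho)).
Proof.
move=> rho_ge0 size_anchors; apply: m_partition_pad.
- exact: left_induced_disjoint.
- move=> k; have [b bP kb] := anchors_cover k rho_ge0.
  by exists (cluster rho b); rewrite // left_inducedE map_f.
- by rewrite size_map.
Qed.

Lemma left_induced_contiguous rho :
  {in left_induced v rho, forall A, contiguous A}.
Proof.
move=> _ /mapP[a _ ->] i j k; rewrite !inE => /andP[ai _] /andP[_ ka].
by rewrite -!(ler_chain chain_v) => /andP[ij jk]; apply/andP; split; lra.
Qed.

Lemma dimension_left_induced m rho : 0 <= rho ->
  dimension v (pad (m := m) (left_induced v rho)) <= rho.
Proof.
move=> rho_ge0; apply: dimension_pad_le => // _ /mapP[a _ ->].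
by apply: extent_le => // j k; rewrite !inE; lra.
Qed.

Lemma lt_size_anchors_optimal m (V : 'I_m -> {set 'I_n}) rho : 0 <= rho ->
  optimal_partition v V -> rho < dimension v V -> (m < size (anchors v rho))%N.
Proof.
move=> rho_ge0 [_ V_min] rho_lt_V; rewrite ltnNge; apply/negP => size_le_m.
have := V_min _ (left_induced_m_partition rho_ge0 size_le_m).
by have := dimension_left_induced m rho_ge0; lra.
Qed.

Lemma separated_lt_length rho s : separated rho s -> (1 < size s)%N ->
  (size s).-1%:R * rho < chain_length v.
Proof.
have last_ge a t : path (beyond rho) a t ->
    v a + (size t)%:R * rho <= v (last a t).
  elim: t a => [|b t IH] a /=; first by rewrite mul0r addr0.
  by move=> /andP[ab /IH]; rewrite -natr1; lra.
case: s => [|a [|b s]] // /pairwise_sorted /= /andP[ab /last_ge b_last] _.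
have := chain_ge0 chain_v a; have := chain_le_length v (last b s).
by rewrite -natr1; lra.
Qed.

Lemma size_anchors_mean m : (0 < m)%N ->
  (size (anchors v (chain_length v / m%:R)) <= m)%N.
Proof.
move=> m_gt0; set rho := _ / _; rewrite leqNgt; apply/negP => m_lt_size.
have rho_ge0 : 0 <= rho by rewrite divr_ge0 ?chain_length_ge0.
have := separated_lt_length (anchors_separated rho_ge0).
rewrite (leq_ltn_trans m_gt0) // => /(_ isT); apply/negP; rewrite -leNgt.
have -> : chain_length v = m%:R * rho.
  by rewrite mulrC divfK // pnatr_eq0 -lt0n.
by rewrite ler_wpM2r // ler_nat -ltnS prednK // (ltn_trans m_gt0).
Qed.

End LeftInduced.

(** * Lower bound on the refresh time *)

Lemma within_continuous_subitv (R : realType) (f : R -> R) (a b c d : R) :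
  a <= c -> d <= b -> {within `[a, b], continuous f}%classic ->
  {within `[c, d], continuous f}%classic.
Proof.
move=> ac db; apply: continuous_subspaceW => t /=; rewrite !in_itv /=; lra.
Qed.

Lemma bounded_derivative_lipschitz (R : realType) (f : R -> R) (K a b : R) :
  a <= b -> {within `[a, b], continuous f}%classic ->
  (forall t, a < t < b -> derivable f t 1 /\ `|f^`()%classic t| <= K) ->
  `|f b - f a| <= K * (b - a).
Proof.
rewrite le_eqVlt => /predU1P[<- _ _|ab f_cont f_deriv].
  by rewrite !subrr normr0 mulr0.
have [t /f_deriv[ft _]|t /f_deriv[_ ftK] ->] :=
    MVT ab _ f_cont (df := f^`()%classic).
  by rewrite derive1E; apply: derivableP.
by rewrite normrM [X in _ * X]ger0_norm ?ler_wpM2r //; lra.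
Qed.

Lemma piecewise_lipschitz (R : realType) (f : R -> R) (K : R) (s : seq R)
    (a b : R) :
  a <= b -> {within `[a, b], continuous f}%classic ->
  (forall t, a < t < b -> t \notin s ->
     derivable f t 1 /\ `|f^`()%classic t| <= K) ->
  `|f b - f a| <= K * (b - a).
Proof.
elim: s a b => [|c s IH] a b ab f_cont f_deriv.
  by apply: bounded_derivative_lipschitz => // t /f_deriv; apply.
have lip_avoiding_c x y : a <= x -> x <= y -> y <= b -> ~~ (x < c < y) ->
    `|f y - f x| <= K * (y - x).
  move=> ax xy yb c_out; apply: IH => // [|t txy ts].
    exact: within_continuous_subitv f_cont.
  apply: f_deriv; first by apply/andP; split; lra.
  by rewrite inE negb_or ts andbT; apply: contraNneq c_out => <-.
have [/andP[ac cb]|] := boolP (a < c < b); last exact: lip_avoiding_c.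
have fac : `|f c - f a| <= K * (c - a).
  by apply: lip_avoiding_c; rewrite ?ltxx ?andbF // ltW.
have fcb : `|f b - f c| <= K * (b - c).
  by apply: lip_avoiding_c; rewrite ?ltxx // ltW.
by have := ler_normD (f b - f c) (f c - f a); rewrite addrA subrK; lra.
Qed.

Lemma robot_trajectory_lipschitz (R : realType) (Tf len : R) (x : R -> R) s t :
  robot_trajectory Tf len x -> 0 <= s <= Tf -> 0 <= t <= Tf ->
  `|x t - x s| <= `|t - s|.
Proof.
case=> x_cont _ [e x_deriv].
wlog st : s t / s <= t.
  move=> W hs ht; have [/W|/ltW/W] := leP s t; first exact.
  by move=> /(_ ht hs); rewrite distrC (distrC t).
move=> /andP[s_ge0 _] /andP[_ tTf].
rewrite [leRHS]ger0_norm ?subr_ge0 // -[leRHS]mul1r.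
apply: (@piecewise_lipschitz _ _ _ e) => //.
  exact: within_continuous_subitv x_cont.
by move=> u /andP[su ut]; apply: x_deriv; apply/andP; split; lra.
Qed.

Section RefreshTime.
Variables (R : realType) (n m : nat) (v : 'I_n -> R) (Tf : R).
Variable (Y : 'I_m -> R -> R).

Lemma refresh_time_ge0 : 0 <= refresh_time v Tf Y.
Proof. exact: bigmax_ge_id. Qed.

Lemma le_refresh_time k (t1 t2 : R) : Omega Tf Y (v k) (t1, t2) ->
  t2 - t1 <= refresh_time v Tf Y.
Proof.
move=> t_Omega; apply: le_trans (le_bigmax _ _ k); apply: ub_le_sup.
  by exists Tf => _ [t [t1P t2P _ _] <-]; lra.
by exists (t1, t2).
Qed.

Lemma refresh_time_le (d : R) : 0 <= Tf -> 0 <= d ->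
  (forall k t1 t2, Omega Tf Y (v k) (t1, t2) -> t2 - t1 <= d) ->
  refresh_time v Tf Y <= d.
Proof.
move=> Tf_ge0 d_ge0 Omega_le; apply: bigmax_le => // k _; apply: ge_sup.
  exists (0 - 0); exists (0, 0) => //.
  by split=> //=; rewrite ?lexx // => i s; lra.
by move=> _ [[t1 t2] t_Omega <-]; apply: Omega_le t_Omega.
Qed.

Lemma refresh_time_visit k (rho t : R) : refresh_time v Tf Y < 2 * rho ->
  rho <= t <= Tf - rho ->
  exists i, exists2 s, `|s - t| < rho & Y i s = v k /\ 0 <= s <= Tf.
Proof.
move=> refresh_lt t_itv; apply: contrapT => no_visit.
have rho_ge0 : 0 <= rho by have := refresh_time_ge0; lra.
suff /le_refresh_time : Omega Tf Y (v k) (t - rho, t + rho) by lra.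
split=> /= [|||i s /andP[s1 s2]]; [by apply/andP; split; lra..|lra|].
apply/eqP => Yis; apply: no_visit; exists i; exists s.
  by rewrite ltr_norml; apply/andP; split; lra.
by split=> //; apply/andP; split; lra.
Qed.

Hypothesis Y_traj : team_trajectory v Tf Y.

Lemma card_robots_left_of_viewpoint k (rho t : R) (c : nat) :
  refresh_time v Tf Y < 2 * rho -> rho <= t <= Tf - rho ->
  (forall s, `|s - t| < rho -> (c <= #|[set i | (Y i s < v k)%R]%SET|)%N) ->
  (c < #|[set i | (Y i t <= v k + rho)%R]%SET|)%N.
Proof.
move=> refresh_lt t_itv c_robots.
have [i [s st [Yis sTf]]] := refresh_time_visit k refresh_lt t_itv.
have refresh_ge0 := refresh_time_ge0.
have tTf : 0 <= t <= Tf by apply/andP; split; lra.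
have Y_near h : Y h s <= v k -> Y h t <= v k + rho.
  have := robot_trajectory_lipschitz (Y_traj h) sTf tTf.
  by rewrite (distrC t); have := ler_norm (Y h t - Y h s); lra.
have -> : c.+1 = (1 + c)%N by [].
apply: (@leq_trans #|i |: [set h | (Y h s < v k)%R]%SET|).
  by rewrite cardsU1 inE Yis ltxx leq_add2l c_robots.
apply/subset_leq_card/fintype.subsetP => h; rewrite !inE.
by case/predU1P => [->|/ltW]; [rewrite Y_near ?Yis | apply: Y_near].
Qed.

(* The robots may exchange their order, so the robots near the anchors are only
   counted, not identified. *)
Lemma card_robots_left_of_last (s : seq 'I_n) k (rho t : R) :
  refresh_time v Tf Y < 2 * rho -> separated v rho (rcons s k) ->
  (size s).+1%:R * rho <= t <= Tf - (size s).+1%:R * rho ->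
  (size s < #|[set i | (Y i t <= v k + rho)%R]%SET|)%N.
Proof.
move=> refresh_lt; have rho_ge0 : 0 <= rho by have := refresh_time_ge0; lra.
elim/last_ind: s k t => [|s j IH] k t; rewrite /separated pairwise_rcons.
  rewrite mul1r => _ t_itv.
  by apply: card_robots_left_of_viewpoint => // u; rewrite leq0n.
rewrite all_rcons -/(separated _ _ _) size_rcons => /andP[/andP[jk _] s_sep].
rewrite -natr1 mulrDl mul1r => t_itv.
have sj_ge0 : 0 <= (size s).+1%:R * rho by rewrite mulr_ge0.
apply: card_robots_left_of_viewpoint => // [|u].
  by apply/andP; split; lra.
rewrite ltr_norml => u_near; apply: leq_trans (IH j u s_sep _) _.
  by apply/andP; split; lra.
by apply/subset_leq_card/fintype.subsetP => i; rewrite !inE; lra.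
Qed.

Lemma size_separated_le_robots (s : seq 'I_n) (rho : R) :
  refresh_time v Tf Y < 2 * rho -> separated v rho s ->
  2 * (size s)%:R * rho <= Tf -> (size s <= m)%N.
Proof.
case/lastP: s => [//|s k] refresh_lt s_sep; rewrite size_rcons => s_Tf.
have := card_robots_left_of_last (t := Tf / 2) refresh_lt s_sep.
have -> : (size s).+1%:R * rho <= Tf / 2 <= Tf - (size s).+1%:R * rho.
  by apply/andP; split; lra.
move=> /(_ isT) s_lt; apply: leq_trans s_lt _.
by rewrite -[leqRHS]card_ord max_card.
Qed.

Lemma optimal_dimension_le_refresh_time (V : 'I_m -> {set 'I_n}) :
  chain v -> (0 < m)%N -> 4 * chain_length v <= Tf ->
  optimal_partition v V -> 2 * dimension v V <= refresh_time v Tf Y.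
Proof.
move=> chain_v m_gt0 length_le V_opt; rewrite leNgt; apply/negP => refresh_lt.
have refresh_ge0 := refresh_time_ge0.
have [rho /andP[rho_gt rho_lt]] : exists rho,
    refresh_time v Tf Y / 2 < rho < dimension v V.
  by exists ((refresh_time v Tf Y / 2 + dimension v V) / 2); lra.
have rho_ge0 : 0 <= rho by lra.
have m_lt_size := lt_size_anchors_optimal chain_v rho_ge0 V_opt rho_lt.
have sep := anchors_separated chain_v rho_ge0.
have size_gt1 := leq_ltn_trans m_gt0 m_lt_size.
have anchors_lt := separated_lt_length chain_v sep size_gt1.
have dim_le := dimension_le_length chain_v V.
move: m_lt_size; rewrite ltnNge => /negP; apply.
apply: size_separated_le_robots sep _; first lra.
rewrite -[size _]prednK ?(ltnW size_gt1) // -natr1; lra.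
Qed.

End RefreshTime.

(** * Zigzag trajectories *)

Lemma exists_period_shift (R : realType) (T t : R) : 0 < T ->
  exists j : int, 0 <= t + j%:~R * T < T.
Proof.
move=> T_gt0; exists (- Num.floor (t / T)); rewrite intrN mulNr.
have := floor_itv (t / T); rewrite intrD ler_pdivlMr // ltr_pdivrMr //.
by move=> jt; apply/andP; split; lra.
Qed.

Section Zigzag.
Variables (R : realType) (l r : R).
Local Notation d := (r - l).
Local Notation zz := (zigzag l r).

Lemma zigzag_periodic (j : int) (t : R) : zz (t + j%:~R * (2 * d)) = zz t.
Proof.
rewrite /zigzag /=; case: eqP => // /eqP d_neq0.
have T_neq0 : 2 * d != 0 by rewrite mulf_neq0.
rewrite (mulrDl t) mulfK // floorDrz ?rpred_int // intrKfloor intrD.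
by congr (_ + Num.min _ _); ring.
Qed.

Hypothesis l_le_r : l <= r.

Lemma zigzagE (t : R) : 0 <= t <= 2 * d -> zz t = l + Num.min t (2 * d - t).
Proof.
move=> t_itv; move: l_le_r; rewrite le_eqVlt => /predU1P[E|lr].
  by rewrite /zigzag E subrr eqxx min_l; lra.
have [td|dt] := leP t (2 * d - t).
  by rewrite (@zigzag_up _ _ _ _ 0 lr) mul0r ?subr0 // mul1r; lra.
by rewrite (@zigzag_down _ _ _ _ 0 lr) mul1r; lra.
Qed.

Lemma zigzag_bounds (t : R) : l <= zz t <= r.
Proof.
move: l_le_r; rewrite le_eqVlt => /predU1P[E|lr].
  by rewrite /zigzag E subrr !eqxx lexx.
have [|j] := @exists_period_shift _ (2 * d) t; first lra.
rewrite -(zigzag_periodic j t); move: (t + _) => s s_itv.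
rewrite zigzagE; last lra.
by have [sd|ds] := leP s (2 * d - s); lra.
Qed.

Lemma zigzag_gt_left (t : R) : 0 < t < 2 * d -> l < zz t.
Proof.
move=> t_itv; rewrite zigzagE; last lra.
by rewrite ltrDl lt_min; apply/andP; split; lra.
Qed.

Lemma zigzag_visits (p t1 t2 : R) : l <= p <= r -> 2 * d < t2 - t1 ->
  exists2 s, t1 < s < t2 & zz s = p.
Proof.
move: l_le_r; rewrite le_eqVlt => /predU1P[E|lr] p_itv dt.
  exists ((t1 + t2) / 2); first by apply/andP; split; lra.
  by rewrite /zigzag E subrr eqxx; lra.
have d_gt0 : 0 < 2 * d by lra.
pose x := (t1 + t2) / 2 - d.
have [j j_itv] := exists_period_shift (p - l - x) d_gt0.
exists (p - l + j%:~R * (2 * d)); last first.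
  by rewrite zigzag_periodic zigzagE ?min_l; lra.
by rewrite /x in j_itv; apply/andP; split; lra.
Qed.

End Zigzag.

Section ProperZigzag.
Variables (R : realType) (l r : R).
Hypothesis lr : l < r.
Local Notation d := (r - l).
Local Notation zz := (zigzag l r).

Let l_le_r : l <= r. Proof. exact: ltW. Qed.
Let period_gt0 : 0 < 2 * d. Proof. by rewrite mulr_gt0 ?subr_gt0. Qed.

Lemma zigzag_dist (t : R) : exists j : int, zz t = l + `|t + j%:~R * (2 * d)|.
Proof.
have [j j_itv] := exists_period_shift t period_gt0.
rewrite -(zigzag_periodic l r j t) zigzagE //; last lra.
have [up|down] := leP (t + j%:~R * (2 * d)) _.
  by exists j; rewrite ger0_norm //; lra.
by exists (j - 1); rewrite intrB ler0_norm; lra.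
Qed.

Lemma zigzag_le_norm (t : R) : zz t <= l + `|t|.
Proof.
have [j j_itv] := exists_period_shift t period_gt0.
rewrite -(zigzag_periodic l r j t) zigzagE ?lerD2l ?ge_min //; last lra.
have [j_le0|j_gt0] := leP j 0; apply/orP.
  have : j%:~R * (2 * d) <= 0 by rewrite pmulr_lle0 // lerz0.
  by left; have := ler_norm t; lra.
have : 1 * (2 * d) <= j%:~R * (2 * d) by rewrite ler_pM2r // ler1z.
by right; have := ler_norm (- t); rewrite normrN; lra.
Qed.

Lemma zigzag_lipschitz (s t : R) : `|zz t - zz s| <= `|t - s|.
Proof.
wlog st : s t / zz s <= zz t.
  move=> W; have [/W//|/ltW/W] := leP (zz s) (zz t).
  by rewrite distrC (distrC t).
rewrite ger0_norm ?subr_ge0 //; have [j zs] := zigzag_dist s.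
have := zigzag_le_norm (t + j%:~R * (2 * d)); rewrite zigzag_periodic.
have := ler_normD (t - s) (s + j%:~R * (2 * d)).
by rewrite addrA subrK; lra.
Qed.

Lemma is_derive_zigzag (j : nat) (t : R) : j%:R * d < t < j.+1%:R * d ->
  is_derive t 1 zz ((-1) ^+ j).
Proof.
move=> /andP[jt tj].
have near_t : \forall u \near t, j%:R * d <= u <= j.+1%:R * d.
  near=> u; apply/andP; split; apply: ltW; near: u.
    exact: lt_nbhsr.
  exact: lt_nbhsl.
have jE : j = (odd j + 2 * j./2)%N by rewrite mul2n odd_double_half.
rewrite -signr_odd; case: (odd j) jE => jE; rewrite jE in near_t.
  apply: (near_eq_is_derive (f := fun u => r - (u - (2 * j./2).+1%:R * d))).
    by near=> u; rewrite (zigzag_down (k := j./2) lr) //; near: u.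
  by apply: is_derive_eq; ring.
apply: (near_eq_is_derive (f := fun u => l + (u - (2 * j./2)%:R * d))).
  by near=> u; rewrite (zigzag_up (k := j./2) lr) //; near: u.
by apply: is_derive_eq; ring.
Unshelve. all: by end_near.
Qed.

Lemma zigzag_piecewise_derivable (Tf : R) : exists e : seq R,
  forall t, 0 < t < Tf -> t \notin e ->
    derivable zz t 1 /\ `|zz^`()%classic t| <= 1.
Proof.
have d_gt0 : 0 < d by rewrite subr_gt0.
exists [seq i%:R * d | i <- iota 0 (Num.truncn (Tf / d)).+1].
move=> t /andP[t_gt0 t_lt_Tf] t_turn.
have /truncn_itv : 0 <= t / d by rewrite divr_ge0 // ltW.
set j := Num.truncn (t / d).
rewrite ler_pdivlMr // ltr_pdivrMr // => /andP[jt tj].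
have [|zz_derivable zzE] := @is_derive_zigzag j t.
  rewrite tj lt_neqAle jt !andbT; apply: contraNneq t_turn => <-.
  apply/mapP; exists j => //; rewrite mem_iota /= add0n ltnS.
  by apply: le_truncn; rewrite ler_pM2r ?invr_gt0 // ltW.
by split=> //; rewrite derive1E zzE normrX normrN1 expr1n.
Qed.

End ProperZigzag.

Lemma robot_trajectory_cst (R : realType) (Tf len p : R) : 0 <= p <= len ->
  robot_trajectory Tf len (fun=> p).
Proof.
move=> p_itv; split=> //.
  by apply: continuous_subspaceT; apply: cst_continuous.
exists [::] => t _ _; split; first exact: derivable_cst.
by rewrite derive1_cst normr0.
Qed.

Lemma robot_trajectory_zigzag (R : realType) (Tf len l r : R) :
  0 <= l -> l <= r -> r <= len -> robot_trajectory Tf len (zigzag l r).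
Proof.
move=> l_ge0; rewrite le_eqVlt => /predU1P[<- l_len|lr r_len].
  have -> : zigzag l l = fun=> l.
    by apply/funext => t; rewrite /zigzag subrr eqxx.
  by apply: robot_trajectory_cst; rewrite l_ge0.
split; last exact: zigzag_piecewise_derivable.
  apply: continuous_subspaceT => t; apply/cvgrPdist_lt => e e_gt0; near=> u.
  apply: le_lt_trans (zigzag_lipschitz lr u t) _.
  by near: u; apply/nbhs_ballP; exists e.
by move=> t _; have := zigzag_bounds (ltW lr) t; lra.
Unshelve. all: by end_near.
Qed.

Section PartitionTrajectory.
Variables (R : realType) (n m : nat) (v : 'I_n -> R) (Tf : R).
Variables (V : 'I_m -> {set 'I_n}) (park : 'I_m -> R).
Hypothesis chain_v : chain v.
Hypothesis V_contiguous : forall i, contiguous (V i).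
Hypothesis park_off_viewpoints : forall i : 'I_m, V i = set0 ->
  0 <= park i <= chain_length v /\ forall k : 'I_n, park i != v k.
Local Notation X := (partition_trajectory v V park).
Local Notation l i := (left_end v (V i)).
Local Notation r i := (right_end v (V i)).

Lemma partition_trajectory_zigzag i k t :
  k \in V i -> X i t = zigzag (l i) (r i) t.
Proof. by rewrite /partition_trajectory; case: eqP => // ->; rewrite inE. Qed.

Lemma team_trajectory_partition : team_trajectory v Tf X.
Proof.
move=> i; rewrite /partition_trajectory.
have [Vi0|Vi_neq0] := eqVneq (V i) set0.
  by apply: robot_trajectory_cst; case: (park_off_viewpoints Vi0).
apply: robot_trajectory_zigzag; first exact: left_end_ge0.
  exact: left_le_right_end.
exact: right_end_le_length.
Qed.

Lemma partition_trajectory_eq_viewpoint i k t : X i t = v k -> k \in V i.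
Proof.
rewrite /partition_trajectory; have [Vi0|Vi_neq0] := eqVneq (V i) set0 => Xt.
  by have [_ /(_ k)] := park_off_viewpoints Vi0; rewrite Xt eqxx.
rewrite (mem_contiguous chain_v) // -Xt.
exact: zigzag_bounds (left_le_right_end v Vi_neq0) t.
Qed.

Lemma image_partition_trajectory :
  chain_length v <= Tf -> image_of v Tf X =1 V.
Proof.
move=> length_le i; apply/setP => k; rewrite inE.
apply/asboolP/idP => [[t [_]]|kV].
  exact: partition_trajectory_eq_viewpoint.
have Vi_neq0 : V i != set0 by apply/set0Pn; exists k.
have lr := left_le_right_end v Vi_neq0.
have l_ge0 := left_end_ge0 chain_v (V i).
have r_le := right_end_le_length v (V i).
have := kV; rewrite (mem_contiguous chain_v) // => /andP[lk kr].
exists (v k - l i); split; first by apply/andP; split; lra.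
by rewrite (partition_trajectory_zigzag _ kV) zigzagE ?min_l; lra.
Qed.

Lemma refresh_time_partition_le : 0 <= Tf -> m_partition V ->
  refresh_time v Tf X <= 2 * dimension v V.
Proof.
move=> Tf_ge0 [_ V_cover]; have dim_ge0 := dimension_ge0 v V.
apply: refresh_time_le => [||k t1 t2 [_ _ t12 not_visited]]; [by [] | lra |].
have : k \in \bigcup_(i < m) V i by rewrite V_cover inE.
case/bigcupP => i _ kV; have Vi_neq0 : V i != set0 by apply/set0Pn; exists k.
have := kV; rewrite (mem_contiguous chain_v) // => k_itv.
rewrite leNgt; apply/negP => dim_lt.
have lr := left_le_right_end v Vi_neq0.
have [|s s_itv zk] := @zigzag_visits _ _ _ lr (v k) t1 t2 k_itv.
  by have := extent_le_dimension v V i; rewrite /extent; lra.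
have := not_visited i s s_itv.
by rewrite (partition_trajectory_zigzag _ kV) zk eqxx.
Qed.

(* The left end of a cluster is visited only by its own robot, which returns to
   it after a full period. *)
Lemma extent_le_refresh_time_partition i :
  2 * chain_length v <= Tf -> m_partition V ->
  2 * extent v (V i) <= refresh_time v Tf X.
Proof.
move=> length_le [V_disjoint _].
have [Vi0|Vi_neq0] := eqVneq (V i) set0.
  have := refresh_time_ge0 v Tf X; have := extent_set0 v.
  by rewrite Vi0; lra.
have [k kV lE] := left_end_attained v Vi_neq0.
have lr := left_le_right_end v Vi_neq0.
have l_ge0 := left_end_ge0 chain_v (V i).
have r_le := right_end_le_length v (V i).
rewrite -[leLHS]subr0 /extent; apply: (le_refresh_time (k := k)).
split=> /= [|||j s s_itv]; [by apply/andP; split; lra..|lra|].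
apply/eqP => Xs; have kVj := partition_trajectory_eq_viewpoint Xs.
have E : j = i.
  apply/eqP; apply/negPn/negP => /V_disjoint/pred0P/(_ k).
  by rewrite /= kVj kV.
move: Xs; rewrite E (partition_trajectory_zigzag _ kV) -lE => Xs.
by have := zigzag_gt_left lr s_itv; rewrite Xs ltxx.
Qed.

Lemma refresh_time_partition : 2 * chain_length v <= Tf -> m_partition V ->
  refresh_time v Tf X = 2 * dimension v V.
Proof.
move=> length_le V_partition; apply: le_anti.
rewrite refresh_time_partition_le //=; last first.
  by have := chain_length_ge0 v; lra.
rewrite -ler_pdivlMl //; apply: bigmax_le => [|i _].
  by rewrite mulr_ge0 ?invr_ge0 ?refresh_time_ge0.
by rewrite ler_pdivlMl //; apply: extent_le_refresh_time_partition.
Qed.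

End PartitionTrajectory.

(** * Scanning the viewpoints *)

Lemma subseq_flatten (T : eqType) (ss : seq (seq T)) (s : seq T) :
  s \in ss -> subseq s (flatten ss).
Proof.
case/splitPr => ss1 ss2; rewrite flatten_cat /=.
by apply: subseq_trans (suffix_subseq _ _); apply: prefix_subseq.
Qed.

Lemma lt_sorted_enum_ord n : sorted <%O (enum 'I_n).
Proof.
rewrite ltEord; have := iota_ltn_sorted 0 n.
by rewrite -val_enum_ord sorted_map.
Qed.

Lemma drop_enum_ord n (k : 'I_n) :
  drop k (enum 'I_n) = k :: drop k.+1 (enum 'I_n).
Proof. by rewrite (drop_nth k) ?size_enum_ord // nth_ord_enum. Qed.

Section Scan.
Variables (R : realType) (n : nat) (v : 'I_n -> R).
Implicit Types (rho x : R) (a j k : 'I_n) (s : seq 'I_n) (P : seq (seq 'I_n)).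

Definition cluster_sets P : seq {set 'I_n} :=
  [seq [set k in s]%SET | s : seq 'I_n <- P].

Lemma scan_from_cost rho x s :
  ((scan_from v rho x s).2 + size (scan_from v rho x s).1.2
     <= 6 * size s + 1)%N.
Proof.
elim: s x => [//|k s IH] x /=; case: ifP => _.
  by have := IH x; case: (scan_from _ _ _ _) => [[c cs] t] /=; lia.
by have := IH (v k); case: (scan_from _ _ _ _) => [[c cs] t] /=; lia.
Qed.

Lemma scan_cost rho :
  ((scan v rho).2 + size (scan v rho).1 <= 6 * n + 1)%N.
Proof.
rewrite /scan; have := size_enum_ord n.
case: (enum 'I_n) => [|k s] /= sn; first lia.
have := scan_from_cost rho (v k) s.
by case: (scan_from _ _ _ _) => [[c cs] t] /=; lia.
Qed.

Lemma flatten_scan_from rho x s :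
  (scan_from v rho x s).1.1 ++ flatten (scan_from v rho x s).1.2 = s.
Proof.
elim: s x => [//|k s IH] x /=; case: ifP => _.
  by have := IH x; case: (scan_from _ _ _ _) => [[c cs] t] /= ->.
by have := IH (v k); case: (scan_from _ _ _ _) => [[c cs] t] /= ->.
Qed.

Lemma flatten_scan rho : flatten (scan v rho).1 = enum 'I_n.
Proof.
rewrite /scan; case: (enum 'I_n) => [|k s] //=.
have := flatten_scan_from rho (v k) s.
by case: (scan_from _ _ _ _) => [[c cs] t] /= ->.
Qed.

Lemma lt_sorted_scan rho s : s \in (scan v rho).1 -> sorted <%O s.
Proof.
move=> /subseq_flatten; rewrite flatten_scan => s_enum.
exact: subseq_lt_sorted s_enum (lt_sorted_enum_ord n).
Qed.

Hypothesis chain_v : chain v.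

Lemma cluster_cons rho k s : 0 <= rho ->
  (forall j, (j \in s) = (k < j)%N && (v j <= v k + rho)) ->
  [set j in k :: s]%SET = cluster v rho k.
Proof.
move=> rho_ge0 mem_s; apply/setP => j; rewrite !inE mem_s ler_chain //.
rewrite [(k <= j)%N]leq_eqVlt val_eqE (eq_sym k).
by have [->|//] := eqVneq j k; rewrite lerDl rho_ge0.
Qed.

Lemma scan_from_left_induced rho fuel p i a : 0 <= rho -> n = (i + p)%N ->
  (p <= fuel)%N -> (forall k, (k < i)%N -> v k <= v a + rho) ->
  let e := (scan_from v rho (v a) (drop i (enum 'I_n))).1 in
  (forall k, (k \in e.1) = (i <= k)%N && (v k <= v a + rho)) /\
  cluster_sets e.2 =
    [seq cluster v rho b | b <- behead (anchors_from v rho fuel a)].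
Proof.
move=> rho_ge0; elim: p fuel i a => [|p IH] fuel i a nE p_fuel below_i.
  rewrite addn0 in nE; rewrite drop_oversize ?size_enum_ord ?nE //=; split.
    by move=> k; rewrite leqNgt -nE ltn_ord.
  case: fuel p_fuel => //= fuel _; rewrite (next_anchor_None _ _).2 // => k.
  by rewrite below_i // -nE.
have i_lt_n : (i < n)%N by lia.
have [k kE] : {k : 'I_n | k = i :> nat} by exists (Ordinal i_lt_n).
have nE' : n = (k.+1 + p)%N by lia.
rewrite -kE in below_i *; rewrite drop_enum_ord /=; case: ifP => ka.
  have [||mem_c cs_eq] := IH fuel k.+1 a nE'; first exact: ltnW.
    by move=> j; rewrite ltnS leq_eqVlt => /predU1P[/val_inj->|/below_i].
  move: mem_c cs_eq; case: (scan_from _ _ _ _) => [[c cs] t] /= mem_c ->.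
  split=> // j; rewrite inE mem_c [(k <= j)%N]leq_eqVlt val_eqE (eq_sym k).
  by have [->|//] := eqVneq j k; rewrite ka.
have {}ka : v a + rho < v k by rewrite ltNge ka.
case: fuel p_fuel => [//|fuel] p_fuel /=.
rewrite (next_anchor_first chain_v below_i ka).
have [//||mem_c cs_eq] := IH fuel k.+1 k nE'.
  by move=> j; rewrite ltnS -(ler_chain chain_v); lra.
rewrite anchors_from_cons; move: mem_c cs_eq.
case: (scan_from _ _ _ _) => [[c cs] t] /= mem_c cs_eq; split.
  by move=> j; rewrite -(ler_chain chain_v); apply/esym/negP => /andP[]; lra.
by rewrite -cs_eq -(cluster_cons rho_ge0 mem_c).
Qed.

Lemma scan_left_induced rho :
  0 <= rho -> cluster_sets (scan v rho).1 = left_induced v rho.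
Proof.
move=> rho_ge0; rewrite left_inducedE /anchors /scan.
case: pickP => [k /eqP k0|no0]; last first.
  case E: (enum 'I_n) => [//|j s].
  have n_gt0 : (0 < n)%N by rewrite -(size_enum_ord n) E.
  by have := no0 (Ordinal n_gt0); rewrite eqxx.
have := drop_enum_ord k; rewrite k0 drop0 => ->.
have nE : n = (1 + n.-1)%N by have := ltn_ord k; lia.
have [||mem_c cs_eq] := @scan_from_left_induced rho n n.-1 1 k rho_ge0 nE.
- exact: leq_pred.
- by move=> j; rewrite ltnS leqn0 -k0 => /eqP/val_inj ->; rewrite lerDl.
rewrite anchors_from_cons /=; move: mem_c cs_eq.
case: (scan_from _ _ _ _) => [[c cs] t] /= mem_c <-.
by rewrite -(cluster_cons (s := c) rho_ge0) // => j; rewrite mem_c k0.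
Qed.

Lemma left_end_lt_sorted k s : sorted <%O (k :: s) ->
  left_end v [set j in k :: s]%SET = v k.
Proof.
move=> ks; apply: le_anti; rewrite left_end_le ?inE ?eqxx //=.
apply: le_bigmin; first exact: chain_le_length.
move=> j; rewrite !inE ler_chain // => /predU1P[->//|js].
by move/lt_path_min/allP/(_ j js): ks; rewrite ltEord => /ltnW.
Qed.

Lemma right_end_lt_sorted k s : sorted <%O (k :: s) ->
  right_end v [set j in k :: s]%SET = v (last k s).
Proof.
rewrite lt_sorted_pairwise lastI pairwise_rcons => /andP[/allP lt_last _].
apply: le_anti; apply/andP; split.
  apply: bigmax_le => [|j]; first exact: chain_ge0.
  rewrite inE mem_rcons inE ler_chain // => /predU1P[->//|/lt_last].
  by rewrite ltEord => /ltnW.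
by rewrite right_end_ge // inE mem_rcons mem_head.
Qed.

End Scan.

Section RobotEnds.
Variables (R : realType) (n : nat) (v : 'I_n -> R).
Implicit Types (s : seq 'I_n) (P : seq (seq 'I_n)).

Definition cluster_ends s : option (R * R) :=
  if s is k :: s' then Some (v k, v (last k s')) else None.

Lemma timed_lastE (T : Type) (x : T) (s : seq T) :
  timed_last x s = (last x s, (size s).+1).
Proof. by elim: s x => [//|y s IH] x /=; rewrite /bind /= IH. Qed.

Lemma robot_ends_value m P :
  (robot_ends v m P).1 = mkseq (fun i => cluster_ends (nth [::] P i)) m.
Proof.
elim: m P => [//|m IH] P; rewrite /mkseq /= -[1%N]addn0 iotaDl -map_comp.
have := IH (behead P).
rewrite /mkseq (eq_map (fun i => congr1 _ (nth_behead _ _ _))).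
by case: P => [|[|k c] P] /= <- //; rewrite timed_lastE.
Qed.

Lemma robot_ends_time m P :
  ((robot_ends v m P).2 <= size (flatten P) + 4 * m + 1)%N.
Proof.
elim: m P => [|m IH] P /=; first by rewrite addnC.
case: P => [|[|k c] P] /=.
- by have := IH [::]; rewrite /=; lia.
- by have := IH P; lia.
- by rewrite timed_lastE /= size_cat; have := IH P; lia.
Qed.

Lemma partition_ends_pad m P : chain v ->
  {in P, forall s, sorted <%O s} ->
  partition_ends v (pad (m := m) (cluster_sets P)) = (robot_ends v m P).1.
Proof.
move=> chain_v P_sorted.
rewrite robot_ends_value /mkseq -val_enum_ord -map_comp; apply: eq_map => i /=.
have -> : pad (cluster_sets P) i = [set k in nth [::] P i]%SET.
  rewrite /pad; have [iP|iP] := ltnP i (size P).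
    by rewrite (nth_map [::]).
  by rewrite !nth_default ?size_map //; apply/setP => k; rewrite !inE.
have : sorted <%O (nth [::] P i).
  have [iP|iP] := ltnP i (size P); last by rewrite nth_default.
  by apply: P_sorted; apply: mem_nth.
case: (nth [::] P i) => [_|k s ks].
  by rewrite ifT //; apply/eqP/setP => k; rewrite !inE.
rewrite ifF; last by apply/negbTE/set0Pn; exists k; rewrite !inE eqxx.
by rewrite left_end_lt_sorted // right_end_lt_sorted.
Qed.

End RobotEnds.

(** * Loops and the bisection algorithm *)

Section While.
Variables (S : Type) (guard : S -> timed bool) (body : S -> timed S).

Lemma while_invariant (inv : S -> Prop) s s' c :
  (forall u, inv u -> inv (body u).1) -> while guard body s s' c ->
  inv s -> inv s'.
Proof. by move=> inv_body; elim=> // u u' d _ _ IH /inv_body. Qed.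

Lemma while_terminates (inv : nat -> S -> Prop) (g b : nat) :
  (forall s, (guard s).2 <= g)%N -> (forall s, (body s).2 <= b)%N ->
  (forall s, inv 0 s -> (guard s).1 = false) ->
  (forall N s, inv N.+1 s -> inv N (body s).1) ->
  forall N s, inv N s ->
  exists s' c, while guard body s s' c /\ (c <= N * (g + b) + g)%N.
Proof.
move=> guard_time body_time inv0 invS.
have stop N s : (guard s).1 = false ->
    exists s' c, while guard body s s' c /\ (c <= N * (g + b) + g)%N.
  move=> gs; exists s, (guard s).2; split; first exact: while_stop.
  by have := guard_time s; lia.
elim=> [|N IH] s inv_s; first by apply: stop; apply: inv0.
case gs: (guard s).1; last exact: stop.
have [s' [c [W c_le]]] := IH _ (invS _ _ inv_s).
exists s', ((guard s).2 + (body s).2 + c)%N; split; first exact: while_iter W.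
by have := guard_time s; have := body_time s; lia.
Qed.

End While.

Lemma while_simulation (S T : Type) (f : S -> T) (inv : S -> Prop)
    (guard : S -> timed bool) (body : S -> timed S)
    (guard' : T -> timed bool) (body' : T -> timed T) s s' c :
  (forall u, (guard' (f u)).1 = (guard u).1) ->
  (forall u, inv u -> (body' (f u)).1 = f (body u).1) ->
  (forall u, inv u -> inv (body u).1) ->
  while guard body s s' c -> inv s ->
  exists c', while guard' body' (f s) (f s') c'.
Proof.
move=> guardE bodyE inv_body; elim=> [u gu _|u u' d gu _ IH inv_u].
  by eexists; apply: while_stop; rewrite guardE.
have [c' W] := IH (inv_body u inv_u); eexists; apply: while_iter.
  by rewrite guardE.
by rewrite bodyE //; apply: W.
Qed.

Section Bisection.
Variables (R : realType) (A : Type) (Pi : R -> timed (seq A)).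
Variables (m : nat) (len eps : R).
Implicit Types (s : bisection_state R A) (P : seq A).

Definition bisection_state_wf s : Prop :=
  let: (a, b, rho, _) := s in [/\ 0 <= a, 0 <= b & rho = (a + b) / 2].

Definition bisection_width s : R := let: (a, b, _, _) := s in b - a.

Lemma bisection_initE :
  (bisection_init A len m).1 = (0, 2 * (len / m%:R), len / m%:R, None).
Proof. by rewrite /= -mulrA; congr (_, _, _, _); lra. Qed.

Lemma bisection_init_wf :
  0 <= len -> bisection_state_wf (bisection_init A len m).1.
Proof.
move=> len_ge0; have : 0 <= len / m%:R by rewrite divr_ge0.
by rewrite bisection_initE; split=> //; lra.
Qed.

Lemma bisection_body_wf s :
  bisection_state_wf s -> bisection_state_wf (bisection_body Pi m s).1.
Proof.
case: s => [[[a b] rho] best] /= [a_ge0 b_ge0 ->].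
by case: ifP => _ /=; split=> //; lra.
Qed.

Lemma bisection_body_width s : bisection_state_wf s ->
  bisection_width (bisection_body Pi m s).1 = bisection_width s / 2.
Proof.
case: s => [[[a b] rho] best] /= [_ _ ->].
by case: ifP => _ /=; lra.
Qed.

Lemma bisection_value P c : 0 <= len -> bisection Pi len m eps P c ->
  exists2 rho, 0 <= rho & P = (Pi rho).1.
Proof.
move=> len_ge0 [a [b [rho [c' [W _]]]]].
pose inv s := bisection_state_wf s /\
  (forall Q, s.2 = Some Q -> exists2 r, 0 <= r & Q = (Pi r).1).
have [||_] := while_invariant (inv := inv) _ W; last exact.
  move=> s [s_wf s_value]; split; first exact: bisection_body_wf.
  case: s s_wf s_value => [[[a1 b1] rho1] best] /= [a_ge0 b_ge0 rhoE].
  case: ifP => _ s_value Q /=; first exact: s_value.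
  by case=> <-; exists rho1 => //; lra.
by split=> //; apply: bisection_init_wf.
Qed.

Lemma bisection_body_found s : s.2 -> (bisection_body Pi m s).1.2.
Proof. by case: s => [[[a b] rho] [best|//]] _ /=; case: ifP. Qed.

Section Termination.
Variable T : nat.
Hypothesis Pi_time : forall rho, ((Pi rho).2 + size (Pi rho).1 <= T)%N.

Lemma bisection_body_time s : ((bisection_body Pi m s).2 <= T + 5)%N.
Proof.
case: s => [[[a b] rho] best] /=.
by have := Pi_time rho; case: ifP => _ /=; lia.
Qed.

Lemma bisection_while_terminates (N : nat) s :
  bisection_state_wf s -> s.2 -> bisection_width s <= 2 * eps * 2 ^+ N ->
  exists a b rho P c,
    while (bisection_guard eps) (bisection_body Pi m) s (a, b, rho, Some P) c /\
    (c <= N * (T + 8) + 3)%N.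
Proof.
move=> s_wf s_found s_width.
pose inv k u := bisection_state_wf u /\ bisection_width u <= 2 * eps * 2 ^+ k.
have [|u|k u||s' [c [W c_le]]] :=
    @while_terminates _ (bisection_guard eps) (bisection_body Pi m) inv
      3 (T + 5) _ bisection_body_time _ _ N s _.
- by case=> [[[]]].
- case: u => [[[a b] rho] best] [_]; rewrite expr0 mulr1 /= => width_le.
  by apply/negbTE; rewrite -leNgt.
- move=> [u_wf u_width]; split; first exact: bisection_body_wf.
  by rewrite bisection_body_width //; move: u_width; rewrite exprS; lra.
- by split.
have := while_invariant bisection_body_found W s_found.
case: s' W => [[[a b] rho] [P|//]] W _.
by exists a, b, rho, P, c; split=> //; lia.
Qed.

Lemma bisection_terminates (N : nat) :
  (size (Pi (len / m%:R)).1 <= m)%N -> 0 < eps < len / m%:R ->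
  len / m%:R <= eps * 2 ^+ N ->
  exists P c, bisection Pi len m eps P c /\ (c <= N.+1 * (T + 8) + 7)%N.
Proof.
set q := len / m%:R => size_le_m eps_lt q_le.
set s0 := (bisection_init A len m).1.
have s0E : s0 = (0, 2 * q, q, None) by apply: bisection_initE.
have s0_guard : (bisection_guard eps s0).1 by rewrite s0E /=; lra.
have s0_wf : bisection_state_wf s0 by rewrite s0E; split=> //; lra.
have [|||a [b [rho [P [c [W c_le]]]]]] :=
    @bisection_while_terminates N (bisection_body Pi m s0).1.
- exact: bisection_body_wf.
- by rewrite s0E /= ltnNge size_le_m.
- by rewrite bisection_body_width // s0E /=; lra.
exists P; eexists; split.
  by exists a, b, rho; eexists; split; [apply: while_iter W | reflexivity].
have -> : (bisection_guard eps s0).2 = 3%N by [].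
by have := bisection_body_time s0; rewrite /=; lia.
Qed.

End Termination.

Lemma bisection_map (B : Type) (f : A -> B) (Pi' : R -> timed (seq B)) P c :
  0 <= len -> (forall rho, 0 <= rho -> (Pi' rho).1 = map f (Pi rho).1) ->
  bisection Pi len m eps P c ->
  exists c', bisection Pi' len m eps (map f P) c'.
Proof.
move=> len_ge0 Pi'E [a [b [rho [c' [W _]]]]].
pose abs s : bisection_state R B := (s.1, omap (map f) s.2).
have [||| |c'' W'] := while_simulation (f := abs) (inv := bisection_state_wf)
    (guard' := bisection_guard eps) (body' := bisection_body Pi' m) _ _ _ W.
- by case=> [[[]]].
- case=> [[[a1 b1] rho1] best] /= [a_ge0 b_ge0 rhoE].
  by rewrite Pi'E ?size_map; last lra; case: ifP.
- exact: bisection_body_wf.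
- exact: bisection_init_wf.
by eexists; exists a, b, rho, c''; split; first exact: W'.
Qed.

End Bisection.

(** * The design procedure *)

Section Design.
Variables (R : realType) (n m : nat) (v : 'I_n -> R) (eps : R).
Hypothesis chain_v : chain v.

Lemma bisection_partition_contiguous (V : 'I_m -> {set 'I_n}) :
  bisection_partition v eps V -> forall i, contiguous (V i).
Proof.
case=> P [c [P_bisection VE]] i.
have [rho _ PE] := bisection_value (chain_length_ge0 v) P_bisection.
by rewrite VE PE; apply: contiguous_pad; apply: left_induced_contiguous.
Qed.

Lemma design_terminates (N : nat) : (0 < m <= n)%N ->
  0 < eps < chain_length v / m%:R -> chain_length v / m%:R <= eps * 2 ^+ N ->
  exists (V : 'I_m -> {set 'I_n}) c,
    [/\ bisection_partition v eps V, design v m eps (partition_ends v V) c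
      & (c <= n * (15 * N + 28))%N].
Proof.
move=> /andP[m_gt0 m_le_n] eps_lt halvings.
have len_ge0 := chain_length_ge0 v.
have mean_ge0 : 0 <= chain_length v / m%:R by rewrite divr_ge0.
have size_mean : (size (scan v (chain_length v / m%:R)).1 <= m)%N.
  rewrite -(size_map (fun s : seq 'I_n => [set k in s]%SET)).
  rewrite -/(cluster_sets _) scan_left_induced // size_map.
  exact: size_anchors_mean.
have [P [c [P_bisection c_le]]] :=
  bisection_terminates (scan_cost v) size_mean eps_lt halvings.
have [rho rho_ge0 PE] := bisection_value len_ge0 P_bisection.
exists (pad (cluster_sets P)), (c + (robot_ends v m P).2)%N; split.
- have [|c' sets_bisection] := bisection_map (f := fun s => [set k in s]%SET)
      (Pi' := fun rho => ret (left_induced v rho)) len_ge0 _ P_bisection.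
    by move=> r r_ge0; rewrite -scan_left_induced.
  by exists (cluster_sets P), c'.
- exists P, c; split=> //; split=> //; apply: partition_ends_pad => //.
  by move=> s; rewrite PE; apply: lt_sorted_scan.
- have := robot_ends_time v m P; rewrite {2}PE flatten_scan size_enum_ord.
  nia.
Qed.

End Design.

Lemma exists_exponent_ln (R : realType) (b x : R) : 1 < b -> 1 <= x ->
  exists N : nat, x <= b ^+ N /\ N%:R <= ln x / ln b + 1.
Proof.
move=> b_gt1 x_ge1; have ln_b_gt0 : 0 < ln b by rewrite ln_gt0.
have /truncn_itv/andP[N_le N_gt] : 0 <= ln x / ln b.
  by rewrite divr_ge0 ?ln_ge0 // ltW.
exists (Num.truncn (ln x / ln b)).+1; split; last by rewrite -natr1 lerD2r.
rewrite -ler_ln ?posrE ?exprn_gt0 ?lnXn //; [|lra..].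
by rewrite -mulr_natl -ler_pdivrMr // ltW.
Qed.

Lemma ln_ratio_le (R : realType) (L q eps : R) :
  0 < q <= L -> 0 < eps <= L^-1 -> ln (q / eps) <= 2 * ln eps^-1.
Proof.
move=> /andP[q_gt0 qL] /andP[eps_gt0 epsL].
have epsV_gt0 : 0 < eps^-1 by rewrite invr_gt0.
have L_gt0 : 0 < L by lra.
have ln_q : ln q <= ln eps^-1.
  rewrite ler_ln ?posrE //; apply: le_trans qL _.
  by rewrite -[L]invrK lef_pV2 ?posrE ?invr_gt0.
by rewrite lnM ?posrE //; lra.
Qed.

Lemma design_running_time (R : realType) (n m : nat) (v : 'I_n -> R)
    (L eps : R) :
  chain v -> (0 < m <= n)%N -> 0 < eps < chain_length v / m%:R ->
  chain_length v / m%:R <= L -> eps <= L^-1 -> eps <= expR (-1) ->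
  exists (V : 'I_m -> {set 'I_n}) c,
    [/\ bisection_partition v eps V, design v m eps (partition_ends v V) c
      & c%:R <= (30 / ln 2 + 43) * n%:R * ln eps^-1].
Proof.
set q := chain_length v / m%:R => chain_v mn eps_itv qL epsL eps_le.
have [eps_gt0 eps_lt_q] := andP eps_itv.
have ratio_ge1 : 1 <= q / eps by rewrite ler_pdivlMr // mul1r ltW.
have [N [N_halvings N_le]] := exists_exponent_ln (ltr1n R 2) ratio_ge1.
have [|V [c [V_bisection V_design c_le]]] :=
    design_terminates chain_v (N := N) mn eps_itv.
  by rewrite [leRHS]mulrC -ler_pdivrMr.
exists V, c; split=> //; set M := ln eps^-1.
have ln2_gt0 : 0 < ln (2 : R) by rewrite ln_gt0 // ltr1n.
have M_ge1 : 1 <= M.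
  rewrite -[1]expRK ler_ln ?posrE ?invr_gt0 ?expR_gt0 //.
  by rewrite -[expR 1]invrK lef_pV2 ?posrE ?invr_gt0 ?expR_gt0 // -expRN.
have {}N_le : N%:R <= 2 * M / ln 2 + 1.
  apply: le_trans N_le _; rewrite lerD2r ler_pM2r ?invr_gt0 //.
  by apply: (ln_ratio_le (L := L)); apply/andP; split; lra.
have {}c_le : c%:R <= n%:R * (15 * N%:R + 28) :> R.
  by rewrite -natrM -natrD -natrM ler_nat.
apply: le_trans c_le _; rewrite [_ * n%:R]mulrC -mulrA ler_wpM2l //.
have -> : (30 / ln 2 + 43) * M = 15 * (2 * M / ln 2) + 43 * M by field; lra.
lra.
Qed.

Theorem mainTheorem7 (R : realType) :
  (* trajectory, image and minimality of the refresh time; [C * v_n <= Tf]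
     renders "Tf is much larger than the single-robot visiting time v_n" *)
  (exists C : R,
     forall (n m : nat) (v : 'I_n -> R) (eps Tf : R)
            (V : 'I_m -> {set 'I_n}) (park : 'I_m -> R),
       chain v -> (0 < m <= n)%N ->
       0 < eps < chain_length v / m%:R ->
       C * chain_length v <= Tf ->
       bisection_partition v eps V ->
       optimal_partition v V ->
       (forall i : 'I_m, V i = set0 ->
          0 <= park i <= chain_length v /\ forall k : 'I_n, park i != v k) ->
       let X := partition_trajectory v V park in
       [/\ team_trajectory v Tf X,
           image_of v Tf X =1 V,
           refresh_time v Tf X = 2 * dimension v V
         & forall Y : 'I_m -> R -> R, team_trajectory v Tf Y ->
             2 * dimension v V <= refresh_time v Tf Y]) /\
  (* running time O(n log (1 / eps)) *)
  (exists K : R,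
     forall L : R, 0 < L ->
     exists eps0 : R, 0 < eps0 /\
     forall (n m : nat) (v : 'I_n -> R) (eps : R),
       chain v -> (0 < m <= n)%N ->
       0 < eps < chain_length v / m%:R ->
       chain_length v / m%:R <= L -> eps <= eps0 ->
       exists (V : 'I_m -> {set 'I_n}) (c : nat),
         [/\ bisection_partition v eps V,
             design v m eps (partition_ends v V) c
           & c%:R <= K * n%:R * ln (eps^-1)]).
Proof.
split.
  exists 4 => n m v eps Tf V park chain_v /andP[m_gt0 _] _ length_le.
  move=> V_bisection V_opt park_off X; have [V_partition _] := V_opt.
  have len_ge0 := chain_length_ge0 v.
  have V_contiguous := bisection_partition_contiguous chain_v V_bisection.
  split; first exact: team_trajectory_partition.
  - by apply: image_partition_trajectory => //; lra.
  - by apply: refresh_time_partition => //; lra.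
  - by move=> Y Y_traj; apply: optimal_dimension_le_refresh_time.
exists (30 / ln 2 + 43) => L L_gt0; exists (Num.min L^-1 (expR (-1))).
split; first by rewrite lt_min invr_gt0 L_gt0 expR_gt0.
move=> n m v eps chain_v mn eps_itv mean_le.
rewrite le_min => /andP[epsL eps_le].
exact: design_running_time mean_le epsL eps_le.
Qed.
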